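(* Let $q$ be a prime power and $n\ge2$. Let $\mathcal P$ be the set of anisotropic points of the Hermitian variety $\mathcal H(n,q^2)$ in $\mathrm{PG}(n,q^2)$, with associated polarity $\perp$. Let $R_0$ be the identity relation on $\mathcal P$ and, for distinct $X,Y\in\mathcal P$, let - $(X,Y)\in R_1$ iff the line $\langle X,Y\rangle$ meets $\mathcal H(n,q^2)$ in exactly $1$ point, - $(X,Y)\in R_{2\perp}$ iff $\langle X,Y\rangle$ meets $\mathcal H(n,q^2)$ in exactly $q+1$ points and $X\in Y^\perp$, - $(X,Y)\in R_{2\not\perp}$ iff $\langle X,Y\rangle$ meets $\mathcal H(n,q^2)$ in exactly $q+1$ points and $X\notin Y^\perp$. Then $R_0,R_1,R_{2\perp},R_{2\not\perp}$ (omitting $R_{2\not\perp}$ when $q=2$, in which case it is empty) constitute an association scheme on $\mathcal P$.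
   Context: $\mathcal H(n,q^2)$ is the set of points of $\mathrm{PG}(n,q^2)$ whose coordinate vectors satisfy $B(x,x)=0$, where $B(x,y)=x_0y_0^q+\dots+x_ny_n^q$ on $\mathbb F_{q^2}^{n+1}$; the polarity is $W^\perp=\{x:B(x,y)=0\ \forall y\in W\}$. Points not on $\mathcal H(n,q^2)$ are anisotropic. Every line of $\mathrm{PG}(n,q^2)$ is contained in $\mathcal H(n,q^2)$ or meets it in $1$ or $q+1$ points. An association scheme on a finite set $\mathcal P$ is a partition of $\mathcal P\times\mathcal P$ into non-empty symmetric relations $R_0,\dots,R_d$, with $R_0$ the identity relation, such that for all $i,j,k$ the number $|\{Z\in\mathcal P:(X,Z)\in R_i,\ (Y,Z)\in R_j\}|$ is the same for all $(X,Y)\in R_k$. *)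

(* Defs.v *)
From HB Require Import structures.
From mathcomp Require Import all_boot all_order all_algebra.

Set Implicit Arguments.
Unset Strict Implicit.
Unset Printing Implicit Defensive.

Import GRing.Theory.
Local Open Scope ring_scope.

Import VectorInternalTheory.

(* Subspaces over a finite field form a finite type, through the canonical
   matrix of a subspace. *)
HB.instance Definition _ (F : finFieldType) (vT : vectType F) :=
  [Countable of {vspace vT} by <:].
HB.instance Definition _ (F : finFieldType) (vT : vectType F) :=
  [Finite of {vspace vT} by <:].

Section HermitianSpace.

Variables (F : finFieldType) (n q : nat).

Local Notation vec := 'rV[F]_n.+1.
Local Notation subspace := {vspace vec}.

Implicit Types (x y : vec) (W X Y L : subspace).

Definition hform x y : F := \sum_i x 0 i * y 0 i ^+ q.

Definition hform_left y x : F^o := hform x y.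

Definition perp W : subspace :=
  (\bigcap_(y | y \in W) lker (linfun (hform_left y)))%VS.

Fact hform_is_linear y : linear (hform_left y).
Proof.
move=> a u v; rewrite /hform_left /hform scaler_sumr -big_split /=.
by apply: eq_bigr => i _; rewrite !mxE mulrDl scalerAl.
Qed.

HB.instance Definition _ y :=
  GRing.isLinear.Build F vec F^o _ (hform_left y)
    (hform_is_linear y).

(* Hence [perp W] is exactly {x : hform x y = 0 for all y in W}. *)
Fact mem_perp W x :
  reflect (forall y, y \in W -> hform x y = 0) (x \in perp W).
Proof.
have -> : (x \in perp W) = [forall (y | y \in W), hform x y == 0].
  apply/idP/forall_inP => [|xW].
    rewrite memvE => /subv_bigcapP xW y /xW.
    by rewrite -memvE memv_ker lfunE.
  rewrite memvE; apply/subv_bigcapP => y /xW.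
  by rewrite -memvE memv_ker lfunE.
by apply: (iffP forall_inP) => xW y /xW => [/eqP|->].
Qed.

Definition pg_points : {set subspace} := [set X | \dim X == 1%N].

Definition hermitian_variety : {set subspace} :=
  [set X in pg_points | [forall x : vec, (x \in X) ==> (hform x x == 0)]].

Definition anisotropic_points : {set subspace} :=
  pg_points :\: hermitian_variety.

Definition meet_count L : nat :=
  #|[set Z in hermitian_variety | (Z <= L)%VS]|.

Local Notation PP := (setX anisotropic_points anisotropic_points).

Definition rel0 : {set subspace * subspace} := [set u in PP | u.1 == u.2].

Definition rel1 : {set subspace * subspace} :=
  [set u in PP | (u.1 != u.2) && (meet_count (u.1 + u.2)%VS == 1%N)].

Definition rel2perp : {set subspace * subspace} :=
  [set u in PP | [&& u.1 != u.2, meet_count (u.1 + u.2)%VS == q.+1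
                   & (u.1 <= perp u.2)%VS]].

Definition rel2nperp : {set subspace * subspace} :=
  [set u in PP | [&& u.1 != u.2, meet_count (u.1 + u.2)%VS == q.+1
                   & ~~ (u.1 <= perp u.2)%VS]].

End HermitianSpace.

(* The relations R_0, ..., R_d are listed in [R].  Library partitions have
   non-empty blocks; [uniq] says that distinct indices give distinct blocks. *)
Definition association_scheme (T : finType) (P : {set T})
    (R : seq {set T * T}) : Prop :=
  [/\ ohead R = Some [set u in setX P P | u.1 == u.2],
      uniq R,
      partition [set:: R] (setX P P),
      forall A, A \in R -> forall X Y, (X, Y) \in A -> (Y, X) \in A &
      forall A B C, A \in R -> B \in R -> C \in R ->
      exists p : nat, forall X Y, (X, Y) \in C ->
        #|[set Z in P | ((X, Z) \in A) && ((Y, Z) \in B)]| = p].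

(* Main.v *)
Require Import Defs.
From mathcomp Require Import all_boot all_order all_algebra all_field zify ring.

(* An anisotropic point is spanned by a vector x with h x x = 1.  For two such
   vectors x, y, the line through x and y is tangent (or a point) exactly when
   N (h x y) = 1, where N a = a^(q+1), and the points are perpendicular exactly
   when h x y = 0.  The relations are therefore boolean combinations of
   equality, T : N (h z x) = h z z, P : h z x = 0 and the full relation, and it
   is enough that the numbers of z with (T or P at x) and (T or P at y) are
   constant on each class.  Fix s = h z x, t = h z y and h z z.  If N (h x y) <> 1
   then z = z0 + u with z0 in <x, y> and u in the nondegenerate complement U of
   <x, y>, so only u with h u u = h z z - h z0 z0 are counted.  Nonzero values are
   all taken equally often on U, and whether this value is 0 depends only on
   whether h x y = 0; this is why all non-perpendicular secant pairs form one
   relation.  If N (h x y) = 1, scale y so that r = x - y is isotropic and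
   orthogonal to x and y; translating by multiples of r then spreads h z z
   uniformly unless s = t. *)

Set Implicit Arguments.
Unset Strict Implicit.
Unset Printing Implicit Defensive.

Import GRing.Theory.
Local Open Scope ring_scope.

(** * Counting in fibres and orbits *)

Lemma card_partition_by (A B : finType) (f : A -> B) (D : {set A}) (E : {set B}) :
  (forall a, a \in D -> f a \in E) ->
  #|D| = (\sum_(b in E) #|[set a in D | f a == b]|)%N.
Proof.
move=> fDE; rewrite -sum1_card (partition_big f (mem E)) //=.
apply: eq_bigr => b _; rewrite -sum1_card; apply: eq_bigl => a.
by rewrite inE.
Qed.

(** The fibres sum to [#|D|], while the bounds give at most [m * #|E|], which is itself at most
    [#|D|]; so every bound is attained. With root bounds for polynomials as input, this yields exact
    counts and surjectivity at once. *)
Lemma tight_fibres (A B : finType) (f : A -> B) (D : {set A}) (E : {set B}) m :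
  (forall a, a \in D -> f a \in E) ->
  (forall b, b \in E -> (#|[set a in D | f a == b]| <= m)%N) ->
  (m * #|E| <= #|D|)%N ->
  (m * #|E|)%N = #|D| /\ forall b, b \in E -> #|[set a in D | f a == b]| = m.
Proof.
move=> fDE le_m le_D; have DE := card_partition_by fDE.
have sumE : (\sum_(b in E) m = m * #|E|)%N by rewrite sum_nat_const mulnC.
have eqD : (m * #|E|)%N = #|D|.
  apply/eqP; rewrite eqn_leq le_D DE -sumE.
  exact: leq_sum.
split=> // b bE; apply/eqP.
have leS : forall b, b \in E ->
  leqif #|[set a in D | f a == b]| m (#|[set a in D | f a == b]| == m).
  by move=> b' b'E; split => //; apply: le_m.
have [_] := leqif_sum leS.
rewrite -DE sumE eqD eqxx => /esym/forall_inP; exact.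
Qed.

Lemma card_roots_leq (F : finFieldType) (p : {poly F}) (D : {set F}) :
  p != 0 -> (forall a, a \in D -> root p a) -> (#|D| <= (size p).-1)%N.
Proof.
move=> p0 Dp; rewrite -ltnS prednK ?size_poly_gt0 // cardE.
apply: max_poly_roots; rewrite ?enum_uniq //.
by apply/allP => a; rewrite mem_enum; apply: Dp.
Qed.

(* Double counting of the pairs (g, z) with P (act g z). *)
Lemma orbit_count (T G : finType) (A : {set G}) (S : {set T})
    (act : G -> T -> T) (P : pred T) :
  (forall g, g \in A -> injective (act g)) ->
  (forall g z, g \in A -> z \in S -> act g z \in S) ->
  (\sum_(z in S) #|[set g in A | P (act g z)]|)%N =
  (#|A| * #|[set z in S | P z]|)%N.
Proof.
move=> inj_act actS.
transitivity (\sum_(z in S) \sum_(g in A | P (act g z)) 1)%N.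
  by apply: eq_bigr => z _; rewrite -sum1_card; apply: eq_bigl => g; rewrite inE.
rewrite (exchange_big_dep (mem A)) => [|z g _ /andP[]] //=.
rewrite -sum_nat_const; apply: eq_bigr => g gA.
have actSE : act g @: S = S.
  apply/eqP; rewrite eqEcard card_imset ?leqnn ?andbT; last exact: inj_act.
  by apply/subsetP => _ /imsetP[z zS ->]; apply: actS.
rewrite sum1dep_card -[LHS](card_imset _ (inj_act g gA)).
apply: eq_card => z; rewrite !inE; apply/imsetP/andP => [[w]|[]].
  by rewrite inE => /and3P[wS _ Pw ->]; split; first exact: actS.
rewrite -{1}actSE => /imsetP[w wS ->] Pw.
by exists w; rewrite // inE wS gA.
Qed.

Section HermitianCounting.

Variables (F : finFieldType) (q : nat) (cj : {rmorphism F -> F}).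
Hypotheses (cjE : forall a, cj a = a ^+ q) (cardF : #|F| = (q ^ 2)%N).
Hypothesis q_gt1 : (1 < q)%N.

(** * Trace and norm from F to its subfield of order q *)

Lemma cjK : involutive cj.
Proof. by move=> a; rewrite !cjE -exprM mulnn -cardF expf_card. Qed.

Lemma normE a : a * cj a = a ^+ q.+1. Proof. by rewrite cjE exprS. Qed.

Lemma cj_norm a : cj (a * cj a) = a * cj a.
Proof. by rewrite rmorphM /= cjK mulrC. Qed.

Lemma norm_eq0 a : (a * cj a == 0) = (a == 0).
Proof. by rewrite normE expf_eq0. Qed.

(** The subfield of order [q]; it contains all traces, all norms and all values [h z z]. *)
Let realset := [set c : F | cj c == c].

Lemma size_realset : (#|realset| <= q)%N.
Proof.
have sz : size ('X^q - 'X : {poly F}) = q.+1.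
  by rewrite size_polyDl size_polyXn // size_polyN size_polyX.
rewrite -[leqRHS]/(q.+1.-1) -sz; apply: card_roots_leq.
  by rewrite -size_poly_gt0 sz.
by move=> a; rewrite inE cjE /root !hornerE subr_eq0.
Qed.

(** The trace maps [F] into [realset], which has at most [q] elements, and each fibre consists of
    roots of X^q + X - c, hence has at most [q] elements. Since [#|F|] is q * q, both bounds are
    equalities. *)
Lemma trace_count :
  #|realset| = q /\
  forall c, cj c = c -> #|[set a | a + cj a == c]| = q.
Proof.
have [||//|/eqP eqD cnt] :=
  @tight_fibres _ _ (fun a : F => a + cj a) [set: F] realset q.
- by move=> a _; rewrite inE rmorphD /= cjK addrC.
- move=> c; rewrite inE => cc.
  have sz : size ('X^q + ('X - c%:P) : {poly F}) = q.+1.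
    by rewrite size_polyDl size_polyXn // size_XsubC.
  rewrite -[leqRHS]/(q.+1.-1) -sz; apply: card_roots_leq.
    by rewrite -size_poly_gt0 sz.
  move=> a; rewrite !inE cjE /root !hornerE => /eqP <-.
  by rewrite /= [a ^+ q + a]addrC subrr.
- by rewrite cardsT cardF expnS expn1 leq_mul2l size_realset orbT.
split.
  by move: eqD; rewrite cardsT cardF expnS expn1 eqn_mul2l -leqn0 leqNgt ltnW //= => /eqP.
move=> c cc; rewrite -[RHS](cnt c) ?inE ?cc //.
by apply: eq_card => a; rewrite !inE.
Qed.

Lemma card_real : #|[set c : F | cj c == c]| = q.
Proof. by case: trace_count. Qed.

Lemma card_trace d c : d != 0 -> cj c = c ->
  #|[set a | a * d + cj (a * d) == c]| = q.
Proof.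
move=> d0 cc; have [_ /(_ c cc) <-] := trace_count.
rewrite -(card_imset _ (mulIf d0)); apply: eq_card => a.
apply/imsetP/idP => [[b] + ->|]; rewrite !inE // => Pa.
by exists (a / d); rewrite ?inE ?divfK.
Qed.

(** Same argument for the norm on nonzero elements: fibres have at most q + 1 elements, at most q -
    1 values are possible, and (q + 1)(q - 1) is the number of nonzero elements. *)
Lemma card_norm c : cj c = c -> c != 0 -> #|[set a | a * cj a == c]| = q.+1.
Proof.
move=> cc c0; pose E := realset :\ 0.
have cardE : (#|E| <= q.-1)%N.
  rewrite -ltnS prednK ?(ltnW q_gt1) //; have := size_realset.
  by rewrite (cardsD1 0) inE rmorph0 eqxx add1n.
have [||//|_ /(_ c) cnt] :=
  @tight_fibres _ _ (fun a : F => a * cj a) [set~ 0] E q.+1.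
- by move=> a; rewrite !inE norm_eq0 cj_norm eqxx => ->.
- move=> b; rewrite 2!inE => /andP[b0 bb].
  have sz := size_XnsubC b (ltn0Sn q).
  rewrite -[leqRHS]/(q.+2.-1) -sz; apply: card_roots_leq.
    by rewrite -size_poly_gt0 sz.
  by move=> a; rewrite !inE normE /root !hornerE subr_eq0 => /andP[].
- have -> : #|[set~ (0 : F)]| = (q.+1 * q.-1)%N.
    by rewrite cardsC1 cardF -mulnn; case: (q) q_gt1 => // m _;
    rewrite [m.+1.-1]/= !mulnS !mulSn.
  by rewrite leq_mul2l cardE orbT.
rewrite -[RHS]cnt ?inE ?c0 ?cc ?eqxx //.
apply: eq_card => a; rewrite !inE andbC; case: eqP => // Na.
by rewrite -norm_eq0 Na.
Qed.

Lemma norm_surj c : cj c = c -> exists a, a * cj a = c.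
Proof.
have [-> _|c0 cc] := eqVneq c 0; first by exists 0; rewrite mul0r.
have := card_norm cc c0; set A := [set _ | _] => cardA.
have /card_gt0P[a] : (0 < #|A|)%N by rewrite cardA.
by rewrite inE => /eqP; exists a.
Qed.

Lemma card_norm0 : #|[set a : F | a * cj a == 0]| = 1%N.
Proof.
rewrite -(cards1 (0 : F)); apply: eq_card => a.
by rewrite !inE norm_eq0.
Qed.

(** * The Hermitian form on vectors *)

Variable n : nat.
Local Notation vec := 'rV[F]_n.+1.
Local Notation h := (@hform F n q).
Implicit Types (x y z u r : vec) (S : {set vec}).

Lemma hformDl x y z : h (x + y) z = h x z + h y z.
Proof. by rewrite /hform -big_split; apply: eq_bigr => i _; rewrite mxE mulrDl. Qed.

Lemma hformZl a x z : h (a *: x) z = a * h x z.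
Proof. by rewrite /hform mulr_sumr; apply: eq_bigr => i _; rewrite mxE mulrA. Qed.

Lemma cj_hform x y : cj (h x y) = h y x.
Proof.
rewrite /hform rmorph_sum; apply: eq_bigr => i _.
by rewrite rmorphM /= -cjE cjK cjE mulrC.
Qed.

Lemma hformDr x y z : h z (x + y) = h z x + h z y.
Proof. by rewrite -cj_hform hformDl rmorphD /= !cj_hform. Qed.

Lemma hformZr a x z : h z (a *: x) = cj a * h z x.
Proof. by rewrite -cj_hform hformZl rmorphM /= cj_hform. Qed.

Lemma hformNl x z : h (- x) z = - h x z.
Proof. by rewrite -scaleN1r hformZl mulN1r. Qed.

Lemma hformNr x z : h z (- x) = - h z x.
Proof. by rewrite -cj_hform hformNl rmorphN /= cj_hform. Qed.

Lemma hform0l z : h 0 z = 0.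
Proof. by rewrite -(scale0r z) hformZl mul0r. Qed.

Lemma hform0r z : h z 0 = 0.
Proof. by rewrite -cj_hform hform0l rmorph0. Qed.

Definition hformE :=
  (hformDl, hformDr, hformZl, hformZr, hformNl, hformNr, hform0l, hform0r).

Lemma cj_hform_diag z : cj (h z z) = h z z. Proof. exact: cj_hform. Qed.

Lemma hform_nondeg r : r != 0 -> exists z, h z r = 1.
Proof.
move=> r0; have /rV0Pn[i ri] := r0.
exists ((r 0 i ^+ q)^-1 *: delta_mx 0 i).
rewrite hformZl /hform (bigD1 i) //= big1 => [|j ji].
  by rewrite mxE !eqxx mul1r addr0 mulVf // expf_neq0.
by rewrite mxE (negbTE ji) andbF mul0r.
Qed.

(** * Counting vectors by the value of h z z, by translating and scaling *)

Definition orth S y : {set vec} := [set z in S | h z y == 0].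
Definition level S (v : F) : {set vec} := [set z in S | h z z == v].
Arguments level S v%_R.

Lemma translate_count S r (P : pred vec) :
  (forall m z, z \in S -> z + m *: r \in S) ->
  (\sum_(z in S) #|[set m | P (z + m *: r)%R]|)%N = (q ^ 2 * #|[set z in S | P z]|)%N.
Proof.
move=> Sr; rewrite -cardF -cardsT.
rewrite -(@orbit_count _ _ [set: F] S (fun m z => z + m *: r)).
- by apply: eq_bigr => z _; apply: eq_card => m; rewrite !inE.
- by move=> m _; apply: addIr.
- by move=> m z _; apply: Sr.
Qed.

(** Each coset z + F x meets the hyperplane orthogonal to x once, which gives the first equation. On
    it the form is [hw z] plus the norm of a free scalar, where [hw z] is the value at the
    projection of z. If [hw z] is 0, the coset has one isotropic vector and it lies in the
    hyperplane, contributing 1 + q; otherwise it has q + 1 isotropic vectors and none in the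
    hyperplane. Either way the coset contributes q + 1. *)
Lemma slice_count S x : h x x = 1 ->
  (forall m z, z \in S -> z + m *: x \in S) ->
  (q ^ 2 * #|orth S x| = #|S|)%N /\
  (#|level S 0|
     + q * #|level (orth S x) 0|
   = q.+1 * #|orth S x|)%N.
Proof.
move=> hx Sx; pose hw z := h z z - h z x * cj (h z x).
have q2 : (0 < q ^ 2)%N by rewrite expn_gt0 ltnW.
have hxm z m : h (z + m *: x) x = h z x + m by rewrite !hformE hx mulr1.
have hzm z m : h (z + m *: x) (z + m *: x)
    = hw z + (h z x + m) * cj (h z x + m).
  rewrite !hformE hx /hw -(cj_hform z x) rmorphD /=; ring.
have hw_real z : cj (hw z) = hw z.
  by rewrite rmorphB cj_norm /= cj_hform_diag.
have solve1 z : #|[set m | h z x + m == 0]| = 1%N.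
  rewrite -(cards1 (- h z x)); apply: eq_card => m.
  by rewrite !inE addrC addr_eq0.
have eq1 : (q ^ 2 * #|orth S x| = #|S|)%N.
  rewrite -(@translate_count S x (fun z => h z x == 0)) // -sum1_card.
  by apply: eq_bigr => z _; rewrite -[RHS](solve1 z);
    apply: eq_card => m; rewrite !inE hxm.
split=> //; apply/eqP; rewrite -(eqn_pmul2l q2); apply/eqP.
rewrite mulnDr [RHS]mulnCA eq1 [X in (_ + X)%N]mulnCA.
rewrite -(@translate_count S x (fun z => h z z == 0)) //.
have -> : level (orth S x) 0 = [set z in S | (h z x == 0) && (h z z == 0)].
  by apply/setP => z; rewrite !inE andbA.
rewrite -(@translate_count S x (fun z => (h z x == 0) && (h z z == 0))) //.
rewrite big_distrr -big_split /= mulnC -sum_nat_const; apply: eq_bigr => z _.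
have shift (P : pred F) : #|[set m | P (h z x + m)]| = #|[set m | P m]|.
  rewrite -[LHS](card_imset _ (addrI (h z x))); apply: eq_card => m.
  apply/imsetP/idP => [[b] + ->|]; rewrite !inE // => Pm.
  by exists (m - h z x); rewrite ?inE addrC subrK.
have -> : #|[set m | h (z + m *: x) (z + m *: x) == 0]|
    = #|[set m | m * cj m == - hw z]|.
  rewrite -(shift (fun m => m * cj m == - hw z)); apply: eq_card => m.
  by rewrite !inE hzm addrC addr_eq0.
have -> : #|[set m | (h (z + m *: x) x == 0)
                      && (h (z + m *: x) (z + m *: x) == 0)]|
    = (hw z == 0%R) :> nat.
  have [hw0|hw0] := eqVneq (hw z) 0.
    rewrite -[RHS](solve1 z); apply: eq_card => m; rewrite !inE hxm hzm hw0 add0r.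
    by case: eqP => // ->; rewrite mul0r eqxx.
  apply/eqP; rewrite cards_eq0 -subset0; apply/subsetP => m.
  rewrite !inE hxm hzm => /andP[/eqP ->].
  by rewrite mul0r addr0 (negbTE hw0).
have [->|hw0] := eqVneq (hw z) 0.
  by rewrite oppr0 card_norm0 muln1 add1n.
by rewrite muln0 addn0 card_norm // ?rmorphN /= ?hw_real // oppr_eq0.
Qed.

(** Moving z to [z + m *: r] adds to [h z z] the trace of [m * cj (h z r)]. As [h z r] is nonzero,
    each element of the subfield is reached for exactly [q] scalars m. *)
Lemma isotropic_translate_count S r v : h r r = 0 -> cj v = v ->
  (forall m z, z \in S -> z + m *: r \in S) ->
  (forall z, z \in S -> h z r != 0) ->
  (q * #|level S v| = #|S|)%N.
Proof.
move=> hr vv Sr S0; apply/eqP.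
rewrite -(eqn_pmul2l (ltnW q_gt1)) mulnA mulnn.
rewrite -(@translate_count S r (fun z => h z z == v)) //.
rewrite mulnC -sum_nat_const; apply/eqP/eq_bigr => z zS.
rewrite -[RHS](@card_trace (cj (h z r)) (v - h z z)); first last.
- by rewrite rmorphB vv cj_hform_diag.
- by rewrite fmorph_eq0 S0.
apply: eq_card => m; rewrite !inE /= !hformE hr !mulr0 addr0 rmorphM /= cjK.
by rewrite cj_hform [RHS]eq_sym subr_eq eq_sym; congr (_ == _); ring.
Qed.

(** Scaling by a nonzero m multiplies [h z z] by the norm of m, and each nonzero norm occurs q + 1
    times. Hence the q - 1 nonzero levels are equally large. *)
Lemma scale_count S c : cj c = c -> c != 0 ->
  (forall m z, z \in S -> m *: z \in S) ->
  (q.-1 * #|level S c| + #|level S 0| = #|S|)%N.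
Proof.
move=> cc c0 Sm.
have inj_scale m : m \in [set~ (0 : F)] -> injective (fun z : vec => m *: z).
  by rewrite !inE => m0; apply: scalerI.
have := @orbit_count _ _ [set~ (0 : F)] S (fun m z => m *: z)
  (fun z => h z z == c) inj_scale (fun m z _ => Sm m z).
rewrite (eq_bigr (fun z => q.+1 * (h z z != 0%R))%N) => [|z _].
  rewrite -big_distrr cardsC1 cardF /= => eq1.
  have -> : #|S| = (\sum_(z in S) (h z z != 0%R) + #|level S 0|)%N.
    rewrite -!sum1_card (bigID (fun z => h z z != 0)) /=; congr (_ + _)%N.
      by rewrite -big_mkcondr.
    by apply: eq_bigl => z; rewrite inE negbK.
  congr (_ + _)%N; apply/eqP; rewrite -(eqn_pmul2l (ltn0Sn q)) eq1 mulnA.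
  by apply/eqP; congr (_ * _)%N; case: (q) q_gt1 => // m _; rewrite -mulnn; lia.
have [hz|hz] := eqVneq (h z z) 0.
  rewrite muln0; apply/eqP; rewrite cards_eq0 -subset0; apply/subsetP => m.
  by rewrite !inE /= !hformE hz !mulr0 [0 == c]eq_sym (negbTE c0) andbF.
rewrite muln1 -[RHS](@card_norm (c / h z z)).
- apply: eq_card => m; rewrite !inE /= !hformE mulrA -(can2_eq (mulfK hz) (divfK hz)).
  have [->|//] := eqVneq m 0.
  by rewrite !mul0r eq_sym (negbTE c0).
- by rewrite fmorph_div /= cc cj_hform_diag.
- by rewrite mulf_neq0 ?invr_eq0.
Qed.

(** * Vectors with prescribed products with x and y *)

Definition perp2 x y : {set vec} := orth (orth setT y) x.

Definition fibre x y (s t v : F) : {set vec} :=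
  [set z | [&& h z x == s, h z y == t & h z z == v]].

Arguments fibre x y (s t v)%_R.

Lemma in_perp2 x y z : (z \in perp2 x y) = (h z x == 0) && (h z y == 0).
Proof. by rewrite !inE andbC. Qed.

(** The two equations of [slice_count] for the whole space determine both cardinals: the number of
    isotropic vectors of the whole space does not involve x. The witnesses are the solutions of
    these equations. *)
Lemma unit_perp_count : exists c d, forall x, h x x = 1 ->
  #|orth setT x| = c /\ #|level (orth setT x) 0| = d.
Proof.
pose c := (#|{: vec}| %/ q ^ 2)%N.
exists c, ((q.+1 * c - #|level setT 0|) %/ q)%N => x hx.
have [m z _|] := @slice_count setT x hx; first by rewrite inE.
rewrite cardsT /c => <-; rewrite mulKn ?expn_gt0 1?ltnW // => <-.
by rewrite addKn mulKn // ltnW.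
Qed.

(** Gram-Schmidt: x is replaced by a unit vector e of <x, y> orthogonal to y, which exists because
    [h w w], equal to 1 - N(h x y), is nonzero. Then [slice_count] is applied along y inside the
    hyperplane orthogonal to e. *)
Lemma nondeg_perp_count : exists c d, forall x y,
  h x x = 1 -> h y y = 1 -> h x y * cj (h x y) != 1 ->
  #|perp2 x y| = c /\ #|level (perp2 x y) 0| = d.
Proof.
have [c1 [d1 cd1]] := unit_perp_count.
exists (c1 %/ q ^ 2)%N, ((q.+1 * (c1 %/ q ^ 2) - d1) %/ q)%N => x y hx hy a1.
pose w := x - h x y *: y.
have hwy : h w y = 0 by rewrite !hformE hy mulr1 subrr.
have hww : h w w = 1 - h x y * cj (h x y).
  rewrite !hformE hx hy -(cj_hform x y); ring.
have [|b Nb] := @norm_surj (h w w)^-1; first by rewrite fmorphV cj_hform.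
pose e := b *: w.
have hww0 : h w w != 0 by rewrite hww subr_eq0 eq_sym.
have b0 : b != 0 by rewrite -norm_eq0 Nb invr_eq0.
have he : h e e = 1 by rewrite hformZl hformZr mulrA Nb mulVf.
have hye : h y e = 0 by rewrite hformZr -cj_hform hwy rmorph0 mulr0.
have perpE : perp2 x y = orth (orth setT e) y.
  apply/setP => z; rewrite !inE /=; case: (h z y =P 0) => [zy|]; rewrite ?andbF //=.
  rewrite !hformE zy mulr0 oppr0 addr0 mulf_eq0 fmorph_eq0 (negbTE b0) //.
  by rewrite andbT.
have [] := cd1 _ he; rewrite perpE => <- <-.
have [m z|<-] := @slice_count (orth setT e) y hy.
  by rewrite !inE hformDl hformZl hye mulr0 addr0.
by rewrite mulKn ?expn_gt0 1?ltnW // => <-; rewrite addKn mulKn // ltnW.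
Qed.

Lemma nondeg_level_count : exists m, forall x y c,
  h x x = 1 -> h y y = 1 -> h x y * cj (h x y) != 1 ->
  cj c = c -> c != 0 -> #|level (perp2 x y) c| = m.
Proof.
have [c1 [d1 cd1]] := nondeg_perp_count.
exists ((c1 - d1) %/ q.-1)%N => x y c hx hy a1 cc c0.
have [<- <-] := cd1 _ _ hx hy a1.
rewrite -(@scale_count (perp2 x y) c) // => [|m z]; last first.
  by rewrite !in_perp2 !hformE => /andP[/eqP-> /eqP->]; rewrite mulr0 eqxx.
by rewrite addnK mulKn // -subn1 subn_gt0.
Qed.

Lemma fibre_shift x y z0 v :
  (forall u, u \in perp2 x y -> h u z0 = 0) ->
  #|fibre x y (h z0 x) (h z0 y) v| = #|level (perp2 x y) (v - h z0 z0)|.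
Proof.
move=> perp_z0; rewrite -[RHS](card_imset _ (addIr z0)); apply: eq_card => z.
apply/idP/imsetP => [|[u]].
  rewrite inE => /and3P[/eqP hzx /eqP hzy /eqP hzz].
  have zP : z - z0 \in perp2 x y.
    by rewrite in_perp2 !hformE hzx hzy !subrr eqxx.
  exists (z - z0); rewrite ?subrK // inE zP /=.
  have := perp_z0 _ zP; rewrite hformDl hformNl => /eqP; rewrite subr_eq0 => /eqP hzz0.
  by rewrite !hformE hzz -(cj_hform z z0) hzz0 cj_hform subrr subr0 eqxx.
rewrite inE => /andP[uP /eqP huu] ->; have hu := perp_z0 _ uP.
move: uP; rewrite in_perp2 inE !hformE -(cj_hform u z0) hu => /andP[/eqP-> /eqP->].
by rewrite rmorph0 !add0r !addr0 huu subrK !eqxx.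
Qed.

Lemma nondeg_fibre_count x y s t v :
  h x x = 1 -> h y y = 1 -> h x y * cj (h x y) != 1 ->
  #|fibre x y s t v| = #|level (perp2 x y)
     (v - ((s - t * cj (h x y)) * cj s + (t - s * h x y) * cj t)
            / (1 - h x y * cj (h x y)))|.
Proof.
move=> hx hy; set a := h x y => a1.
have d0 : 1 - a * cj a != 0 by rewrite subr_eq0 eq_sym.
(* [z0] solves the linear system for the coordinates in x and y of a vector with products s and t; 1
   - N(a) is its Gram determinant. *)
pose z0 := ((s - t * cj a) / (1 - a * cj a)) *: x
         + ((t - s * a) / (1 - a * cj a)) *: y.
have hzx : h z0 x = s.
  by rewrite !hformE hx -(cj_hform x y) -/a; field.
have hzy : h z0 y = t by rewrite !hformE hy -/a; field.
have -> : ((s - t * cj a) * cj s + (t - s * a) * cj t) / (1 - a * cj a) = h z0 z0.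
  by rewrite {1}/z0 hformDl !hformZl -(cj_hform z0 x) -(cj_hform z0 y) hzx hzy; field.
rewrite -{1}hzx -{1}hzy; apply: fibre_shift => u.
by rewrite in_perp2 !hformE => /andP[/eqP-> /eqP->]; rewrite !mulr0 addr0.
Qed.

(** Here [r = x - y] spans the radical of <x, y>, and prescribing products s with x and t with y
    amounts to prescribing s with x and s - t with r. Translation by r preserves these conditions
    and, when s differs from t, equidistributes [h z z]. *)
Lemma deg_count : exists c d m, forall x y,
  h x x = 1 -> h y y = 1 -> h x y = 1 -> x != y ->
  [/\ #|perp2 x y| = c, #|level (perp2 x y) 0| = d &
      forall s t v, s != t -> cj v = v -> #|fibre x y s t v| = m].
Proof.
have [c1 [d1 cd1]] := unit_perp_count.
have q2_gt0 : (0 < q ^ 2)%N by rewrite expn_gt0 ltnW.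
have q_gt0 : (0 < q)%N by rewrite ltnW.
pose c := (c1 %/ q ^ 2)%N.
exists c, (d1 - (c1 - c) %/ q)%N, (c %/ q)%N => x y hx hy hxy neq_xy.
have [cx dx] := cd1 x hx.
have hyx : h y x = 1 by rewrite -cj_hform hxy rmorph1.
pose r := x - y.
have r0 : r != 0 by rewrite subr_eq0.
have hrx : h r x = 0 by rewrite !hformE hx hyx subrr.
have hry : h r y = 0 by rewrite !hformE hxy hy subrr.
have hrr : h r r = 0 by rewrite {2}/r hformDr hformNr hrx hry subrr.
have hxr : h x r = 0 by rewrite -cj_hform hrx rmorph0.
have hr z : h z r = h z x - h z y by rewrite hformDr hformNr.
(* Translation by [z1] changes the product with r freely while keeping the product with x, so all
   the sets [XR s d] have the same size. *)
have [z1 [hz1x hz1r]] : exists z1, h z1 x = 0 /\ h z1 r = 1.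
  have [z hzr] := hform_nondeg r0; exists (z - h z x *: x).
  by rewrite !hformDl !hformNl !hformZl hzr hxr hx; split; ring.
pose X s := [set z | h z x == s].
pose XR s d := [set z | (h z x == s) && (h z r == d)].
have card_XR s d : (q ^ 2 * #|XR s d| = #|X s|)%N.
  have -> : XR s d = [set z in X s | h z r == d] by apply/setP => z; rewrite !inE.
  rewrite -(@translate_count (X s) z1 (fun z => h z r == d)) => [|m z]; last first.
    by rewrite !inE hformDl hformZl hz1x mulr0 addr0.
  rewrite -[RHS]sum1_card; apply: eq_bigr => z _.
  rewrite -[RHS](cards1 (d - h z r));
  apply: eq_card => m; rewrite !inE hformDl hformZl hz1r mulr1.
  by rewrite addrC; apply/eqP/eqP => [<-|->]; rewrite ?addrK ?subrK.
have card_X s : #|X s| = #|X 0|.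
  have card1 t : (q ^ 2 * #|X t|)%N = #|{: vec}|.
    rewrite -cardsT.
    have -> : X t = [set z in setT | h z x == t] by apply/setP => z; rewrite !inE.
    rewrite -(@translate_count setT x (fun z => h z x == t)) => [|m z _]; last by rewrite inE.
    rewrite -[RHS]sum1_card; apply: eq_bigr => z _.
    rewrite -[RHS](cards1 (t - h z x));
    apply: eq_card => m; rewrite !inE !hformE hx mulr1.
    by rewrite addrC; apply/eqP/eqP => [<-|->]; rewrite ?addrK ?subrK.
  by apply/eqP; rewrite -(eqn_pmul2l q2_gt0) !card1.
have X0 : #|X 0| = c1.
  by rewrite -cx; apply: eq_card => z; rewrite !inE.
have XRc s d : #|XR s d| = c by rewrite /c -X0 -(card_X s) -(card_XR s d) mulKn.
have perpE : perp2 x y = XR 0 0.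
  apply/setP => z; rewrite in_perp2 inE hr; case: eqP => // ->.
  by rewrite sub0r oppr_eq0.
have q_level S v : cj v = v -> (forall m z, z \in S -> z + m *: r \in S) ->
    (forall z, z \in S -> h z r != 0) -> #|level S v| = (#|S| %/ q)%N.
  by move=> vv Sr S0; rewrite -(@isotropic_translate_count S r v) // mulKn.
split.
- by rewrite perpE XRc.
(* Among the vectors orthogonal to x but not to r, the proportion 1/q is isotropic. Removing these
   from the isotropic vectors orthogonal to x leaves those of [perp2 x y]. *)
- pose S := X 0 :\: XR 0 0.
  have cardS : #|S| = (c1 - c)%N.
    rewrite cardsD (setIidPr _) ?X0 ?XRc //.
    by apply/subsetP => z; rewrite !inE => /andP[].
  have levelS : #|level S 0| = (#|S| %/ q)%N.
    apply: q_level; first exact: rmorph0.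
      by move=> m z; rewrite !inE !hformDl !hformZl hrx hrr !mulr0 !addr0.
    by move=> z; rewrite !inE negb_and => /andP[/orP[/negbTE->|]].
  rewrite -dx -cardS -levelS perpE.
  have -> : level (XR 0 0) 0 = level (orth setT x) 0 :\: level S 0.
    apply/setP => z; rewrite !inE.
    by case: (h z x == 0); case: (h z r == 0); case: (h z z == 0).
  rewrite cardsD (setIidPr _) //; apply/subsetP => z; rewrite !inE.
  by case: (h z x == 0); case: (h z r == 0); case: (h z z == 0).
- move=> s t v st vv; rewrite -(XRc s (s - t)).
  have -> : fibre x y s t v = level (XR s (s - t)) v.
    apply/setP => z; rewrite !inE hr -andbA; case: eqP => // ->.
    by rewrite (inj_eq (addrI s)) eqr_opp.
  apply: q_level => // [m z|z].
    by rewrite !inE !hformDl !hformZl hrx hrr !mulr0 !addr0.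
  by rewrite inE => /andP[_ /eqP ->]; rewrite subr_eq0.
Qed.

(** * Counts of vectors tangent or orthogonal to two unit vectors *)

(** For a unit vector x this is the vanishing of the Gram determinant of x and z; it includes the
    multiples z of x. *)
Definition tang x z := h z x * cj (h z x) == h z z.
Definition ortho x z := h z x == 0.

Definition vcount (f g : rel vec) x y :=
  #|[set z | [&& h z z != 0, f x z & g y z]]|.

(** The possible pairs of products of z with x and y. Tangency at x forces [h z z] to be the norm of
    the first entry s, so anisotropy of z becomes the condition that s is nonzero. *)
Definition tt_pairs := [set st : F * F |
  (st.1 != 0) && (st.1 * cj st.1 == st.2 * cj st.2)].
Definition tp_pairs := [set st : F * F | (st.1 != 0) && (st.2 == 0)].

Lemma card_fibres x y (A : {set vec}) (E : {set F * F}) :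
  (forall z, (z \in A) =
     ((h z x, h z y) \in E) && (h z z == h z x * cj (h z x))) ->
  #|A| = (\sum_(st in E) #|fibre x y st.1 st.2 (st.1 * cj st.1)%R|)%N.
Proof.
move=> AE; rewrite (@card_partition_by _ _ (fun z => (h z x, h z y)) A E); last first.
  by move=> z; rewrite AE => /andP[].
apply: eq_bigr => -[s t] stE; apply: eq_card => z.
rewrite !inE AE -pair_eqE /pair_eq /=.
case: (h z x =P s) => [->|]; rewrite ?andbF //=.
by case: (h z y =P t) => [->|]; rewrite ?andbF //= stE andbT.
Qed.

Lemma vcount_tt x y : vcount tang tang x y =
  (\sum_(st in tt_pairs) #|fibre x y st.1 st.2 (st.1 * cj st.1)%R|)%N.
Proof.
apply: card_fibres => z; rewrite !inE /= /tang -(norm_eq0 (h z x)).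
rewrite [h z z == _ * _]eq_sym; case: (_ =P h z z) => [->|]; last by rewrite !andbF.
by rewrite andbT [h z z == _ * _]eq_sym.
Qed.

Lemma vcount_tp x y : vcount tang ortho x y =
  (\sum_(st in tp_pairs) #|fibre x y st.1 st.2 (st.1 * cj st.1)%R|)%N.
Proof.
apply: card_fibres => z; rewrite !inE /= /tang /ortho -(norm_eq0 (h z x)).
rewrite [h z z == _ * _]eq_sym; case: (_ =P h z z) => [->|]; last by rewrite !andbF.
by rewrite andbT.
Qed.

Lemma vcount_pp x y :
  vcount ortho ortho x y = (#|perp2 x y| - #|level (perp2 x y) 0|)%N.
Proof.
have -> : level (perp2 x y) 0 = perp2 x y :&: level (perp2 x y) 0.
  by apply/setP => z; rewrite !inE; case: (h z x == 0); case: (h z y == 0).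
rewrite -cardsD; apply: eq_card => z; rewrite !inE /ortho.
by case: (h z x == 0); case: (h z y == 0); case: (h z z == 0).
Qed.

Lemma vcount_self : exists tt tp pp, forall x, h x x = 1 ->
  [/\ vcount tang tang x x = tt, vcount tang ortho x x = tp
    & vcount ortho ortho x x = pp].
Proof.
have [c [d cd]] := unit_perp_count.
exists (\sum_(st in tt_pairs) (if st.1 == st.2 then d else 0))%N, 0%N, (c - d)%N => x hx.
have perp2xx : perp2 x x = orth setT x.
  by apply/setP => z; rewrite !inE andbb.
have [cx dx] := cd x hx.
split.
(* Only pairs with s = t occur. For these z = s x + u with u orthogonal to x, and since [h z z] is
   the norm of s, u is isotropic. *)
- rewrite vcount_tt; apply: eq_bigr => -[s t] _ /=; case: eqP => [<-|st].
    have {1 2}-> : s = h (s *: x) x by rewrite hformZl hx mulr1.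
    rewrite fibre_shift.
      by rewrite perp2xx hformZl hformZr hx mulr1 subrr.
    by move=> u; rewrite in_perp2 => /andP[/eqP hux _]; rewrite hformZr hux mulr0.
  apply/eqP; rewrite cards_eq0 -subset0; apply/subsetP => z; rewrite !inE.
  by case: eqP => //= ->; case: eqP.
- apply/eqP; rewrite cards_eq0 -subset0; apply/subsetP => z; rewrite !inE /tang /ortho.
  case: (h z x =P 0) => [->|]; rewrite ?andbF // mul0r eq_sym.
  by case: eqP.
- by rewrite vcount_pp perp2xx cx dx.
Qed.

(** Each fibre corresponds to a level of [perp2 x y] at a nonzero value, so all fibres have the
    common size given by [nondeg_level_count]. The work lies in showing that this value never
    vanishes, whether or not x and y are orthogonal. *)
Lemma vcount_nondeg_tt : exists tt, forall x y,
  h x x = 1 -> h y y = 1 -> h x y * cj (h x y) != 1 -> vcount tang tang x y = tt.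
Proof.
have [m cm] := nondeg_level_count.
exists (\sum_(st in tt_pairs) m)%N => x y hx hy a1.
rewrite vcount_tt; apply: eq_bigr => -[s t]; rewrite inE /= => /andP[s0 /eqP st].
rewrite nondeg_fibre_count //; set a := h x y in a1 *.
have d0 : 1 - a * cj a != 0 by rewrite subr_eq0 eq_sym.
apply: cm => //.
  by rewrite !(rmorphB, rmorphD, rmorphM, fmorphV, rmorph1) /= !cjK; field.
apply: contra a1 => /eqP eq0.
(* If the level were 0, then w would be a root of (X - b) (X - b N(a)), and
   N(w - b) = 0 would give N(a) = 1. *)
pose w := s * a * cj t; pose b := s * cj s.
have wE : w + cj w = b * (1 + a * cj a).
  have : (1 - a * cj a) * 0 = 0 by rewrite mulr0.
  rewrite -{1}eq0 /w /b !rmorphM /= cjK => eq1.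
  by apply/eqP; rewrite -subr_eq0 -eq1; apply/eqP; field: st.
have : (w - b) * cj (w - b) == 0.
  have bb : cj b = b by rewrite cj_norm.
  have ww : w * cj w = b * b * (a * cj a).
    by rewrite /w /b {2}st !rmorphM /= cjK; ring.
  rewrite rmorphB bb mulrBl !mulrBr ww.
  have -> : b * b * (a * cj a) - w * b - (b * cj w - b * b)
    = b * b * (1 + a * cj a) - b * (w + cj w) by ring.
  by rewrite wE; apply/eqP; ring.
rewrite norm_eq0 subr_eq0 => /eqP wb.
have b0 : b != 0 by rewrite norm_eq0.
have bb : cj b = b by rewrite cj_norm.
move: wE; rewrite wb bb mulrDr mulr1 => /addrI /eqP.
by rewrite -{1}[b]mulr1 (inj_eq (mulfI b0)) eq_sym.
Qed.

(** For nonzero s the resulting level is 0 exactly when [h x y] is 0. Of the three counts, this is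
    the one whose evaluation distinguishes orthogonal from non-orthogonal secant pairs. *)
Lemma tp_level x y s : h x x = 1 -> h y y = 1 -> h x y * cj (h x y) != 1 ->
  #|fibre x y s 0 (s * cj s)| =
  #|level (perp2 x y)
     (- (s * cj s * (h x y * cj (h x y)) / (1 - h x y * cj (h x y))))|.
Proof.
move=> hx hy a1; rewrite nondeg_fibre_count //.
have d0 : 1 - h x y * cj (h x y) != 0 by rewrite subr_eq0 eq_sym.
by congr #|level _ _|; rewrite rmorph0; field.
Qed.

Lemma vcount_perp : exists tt tp pp, forall x y,
  h x x = 1 -> h y y = 1 -> h x y = 0 ->
  [/\ vcount tang tang x y = tt, vcount tang ortho x y = tp
    & vcount ortho ortho x y = pp].
Proof.
have [tt ctt] := vcount_nondeg_tt.
have [c [d cd]] := nondeg_perp_count.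
exists tt, (\sum_(st in tp_pairs) d)%N, (c - d)%N => x y hx hy hxy.
have a1 : h x y * cj (h x y) != 1 by rewrite hxy mul0r eq_sym oner_eq0.
have [cx dx] := cd x y hx hy a1.
split; first exact: ctt.
- rewrite vcount_tp; apply: eq_bigr => -[s t]; rewrite inE /= => /andP[s0 /eqP ->].
  by rewrite tp_level // hxy mul0r mulr0 mul0r oppr0.
- by rewrite vcount_pp cx dx.
Qed.

Lemma vcount_nperp : exists tt tp pp, forall x y,
  h x x = 1 -> h y y = 1 -> h x y * cj (h x y) != 1 -> h x y != 0 ->
  [/\ vcount tang tang x y = tt, vcount tang ortho x y = tp
    & vcount ortho ortho x y = pp].
Proof.
have [tt ctt] := vcount_nondeg_tt.
have [c [d cd]] := nondeg_perp_count.
have [m cm] := nondeg_level_count.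
exists tt, (\sum_(st in tp_pairs) m)%N, (c - d)%N => x y hx hy a1 a0.
have [cx dx] := cd x y hx hy a1.
split; first exact: ctt.
- rewrite vcount_tp; apply: eq_bigr => -[s t]; rewrite inE /= => /andP[s0 /eqP ->].
  have d0 : 1 - h x y * cj (h x y) != 0 by rewrite subr_eq0 eq_sym.
  rewrite tp_level //; apply: cm => //.
    by rewrite rmorphN fmorph_div rmorphB rmorph1 rmorphM /= !cj_norm.
  by rewrite oppr_eq0 !mulf_neq0 ?invr_eq0 ?fmorph_eq0.
- by rewrite vcount_pp cx dx.
Qed.

Lemma vcount_tangent : exists tt tp pp, forall x y,
  h x x = 1 -> h y y = 1 -> h x y * cj (h x y) = 1 -> x != h x y *: y ->
  [/\ vcount tang tang x y = tt, vcount tang ortho x y = tp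
    & vcount ortho ortho x y = pp].
Proof.
have [c [d [m cdm]]] := deg_count.
exists (\sum_(st in tt_pairs) (if st.1 == st.2 then d else m))%N,
  (\sum_(st in tp_pairs) m)%N, (c - d)%N => x y hx hy a1.
(* Since N(h x y) = 1, [y'] is another unit vector on the same point, now with [h x y' = 1] as
   [deg_count] requires; [tang] and [ortho] do not see the change. *)
set y' := _ *: y => neq_xy.
have hy' : h y' y' = 1 by rewrite hformZl hformZr hy mulr1.
have hxy' : h x y' = 1 by rewrite hformZr mulrC.
have a0 : h x y != 0.
  by apply: contraTneq (oner_neq0 F) => a0; rewrite -a1 a0 mul0r eqxx.
have tangy' z : tang y' z = tang y z.
  rewrite /tang hformZr rmorphM /= cjK; congr (_ == _).
  by rewrite mulrACA [cj _ * _]mulrC a1 mul1r.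
have orthoy' z : ortho y' z = ortho y z.
  by rewrite /ortho hformZr mulf_eq0 fmorph_eq0 (negbTE a0).
have vcounty f g : (forall z, g y' z = g y z) -> vcount f g x y = vcount f g x y'.
  by move=> gy; apply: eq_card => z; rewrite !inE gy.
have [cx dx mx] := cdm x y' hx hy' hxy' neq_xy.
rewrite !vcounty //; split.
- rewrite vcount_tt; apply: eq_bigr => -[s t] _ /=; case: eqP => [<-|/eqP st]; last first.
    by rewrite mx // cj_norm.
  have {1}-> : s = h (s *: x) x by rewrite hformZl hx mulr1.
  have {2}-> : s = h (s *: x) y' by rewrite hformZl hxy' mulr1.
  rewrite fibre_shift.
    by rewrite hformZl hformZr hx mulr1 subrr.
  by move=> u; rewrite in_perp2 => /andP[/eqP hux _]; rewrite hformZr hux mulr0.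
- rewrite vcount_tp; apply: eq_bigr => -[s t]; rewrite inE /= => /andP[s0 /eqP ->].
  by rewrite mx // cj_norm.
- by rewrite vcount_pp cx dx.
Qed.

(** * From vectors to projective points and lines *)

Local Notation subspace := {vspace vec}.
Local Notation PP := (anisotropic_points F n q).
Implicit Types (X Y Z : subspace).

Lemma q2_pred_gt0 : (0 < (q ^ 2).-1)%N.
Proof. by rewrite -subn1 subn_gt0 -{1}(exp1n 2) ltn_exp2r. Qed.

Lemma pg_pointP X : reflect (exists2 x, x != 0 & X = <[x]>%VS) (X \in pg_points F n).
Proof.
rewrite inE; apply: (iffP eqP) => [dX|[x x0 ->]]; last by rewrite dim_vline x0.
have x0 : vpick X != 0 by rewrite vpick0 -dimv_eq0 dX.
exists (vpick X) => //; apply/esym/eqP.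
by rewrite eqEdim dim_vline x0 dX -memvE memv_pick.
Qed.

Lemma line_in_variety z : z != 0 ->
  (<[z]>%VS \in hermitian_variety F n q) = (h z z == 0).
Proof.
move=> z0; rewrite inE; have -> : <[z]>%VS \in pg_points F n by apply/pg_pointP; exists z.
apply/forallP/eqP => [/(_ z)|hz w]; first by rewrite memv_line => /eqP.
by apply/implyP => /vlineP[k ->]; rewrite !hformE hz !mulr0.
Qed.

Lemma line_anisotropic z : (<[z]>%VS \in PP) = (h z z != 0).
Proof.
have [->|z0] := eqVneq z 0; last first.
  rewrite in_setD line_in_variety //.
  by have -> : <[z]>%VS \in pg_points F n; [apply/pg_pointP; exists z | rewrite andbT].
rewrite hform0l eqxx in_setD [_ \in pg_points _ _]inE dim_vline eqxx.
by rewrite andbF.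
Qed.

Lemma anisotropic_unit X : X \in PP -> exists2 x, h x x = 1 & X = <[x]>%VS.
Proof.
move=> XP; have /pg_pointP[x x0 defX] : X \in pg_points F n by case/setDP: XP.
move: XP; rewrite defX line_anisotropic => hx.
have [|b Nb] := @norm_surj (h x x)^-1; first by rewrite fmorphV cj_hform.
have b0 : b != 0 by rewrite -norm_eq0 Nb invr_eq0.
exists (b *: x); first by rewrite !hformE mulrA Nb mulVf.
apply/eqP; rewrite eqEsubv -!memvE; apply/andP; split; last by rewrite memvZ ?memv_line.
by apply/vlineP; exists b^-1; rewrite scalerA mulVf ?scale1r.
Qed.

Lemma card_nonzero_scalings z : z != 0 ->
  #|[set w : vec | (w != 0) && (<[w]>%VS == <[z]>%VS)]| = (q ^ 2).-1.
Proof.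
move=> z0; rewrite -cardF -(cardsC1 (0 : F)).
have inj_z : injective (fun m : F => m *: z).
  move=> a b /eqP; rewrite -subr_eq0 -scalerBl scaler_eq0 (negbTE z0) orbF subr_eq0.
  by move/eqP.
rewrite -[RHS](card_imset _ inj_z); apply: eq_card => w.
rewrite inE; apply/andP/imsetP => [[w0 /eqP wz]|[m]].
  have /vlineP[m wE] : w \in <[z]>%VS by rewrite -wz memv_line.
  exists m => //; rewrite !inE; apply: contraNneq w0 => m0.
  by rewrite wE m0 scale0r.
rewrite !inE => m0 ->; rewrite scaler_eq0 negb_or m0 z0; split=> //.
by rewrite eqEdim !dim_vline scaler_eq0 negb_or m0 z0 andbT -memvE memvZ ?memv_line.
Qed.

Lemma card_points (f : pred subspace) :
  ((q ^ 2).-1 * #|[set Z in pg_points F n | f Z]|)%N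
  = #|[set z : vec | (z != 0) && f <[z]>%VS]|.
Proof.
rewrite (@card_partition_by _ _ (fun z : vec => <[z]>%VS) _
  [set Z in pg_points F n | f Z]) => [|z]; last first.
  rewrite inE => /andP[z0 fz]; rewrite inE fz andbT.
  by apply/pg_pointP; exists z.
rewrite mulnC -sum_nat_const; apply: eq_bigr => Z.
rewrite inE => /andP[/pg_pointP[z z0 ->] fz].
rewrite -(card_nonzero_scalings z0); apply: eq_card => w; rewrite !inE.
by case: (_ =P <[z]>%VS) => [->|]; rewrite ?andbF // fz !andbT.
Qed.

Lemma card_anisotropic (f : pred subspace) :
  ((q ^ 2).-1 * #|[set Z in PP | f Z]|)%N
  = #|[set z : vec | (h z z != 0) && f <[z]>%VS]|.
Proof.
have -> : [set Z in PP | f Z] = [set Z in pg_points F n | (Z \in PP) && f Z].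
  by apply/setP => Z; rewrite !inE; case: (\dim Z == 1%N); rewrite ?andbF.
rewrite card_points; apply: eq_card => z; rewrite inE line_anisotropic inE.
by have [->|] := eqVneq z 0; rewrite ?hform0l ?eqxx.
Qed.

Lemma eq_lines x z : h x x = 1 -> h z z != 0 ->
  (<[x]>%VS == <[z]>%VS) = (z == h z x *: x).
Proof.
move=> hx hz; apply/eqP/eqP => [xz|zE].
  have /vlineP[k ->] : z \in <[x]>%VS by rewrite xz memv_line.
  by rewrite hformZl hx mulr1.
have zx0 : h z x != 0.
  by apply: contraNneq hz => zx; rewrite zE zx scale0r hform0l.
apply/eqP; rewrite eqEsubv -!memvE; apply/andP; split; apply/vlineP.
  by exists (h z x)^-1; rewrite {2}zE scalerA mulVf ?scale1r.
by exists (h z x).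
Qed.

Lemma tang_line x z : h x x = 1 -> h z z != 0 ->
  <[x]>%VS = <[z]>%VS -> tang x z.
Proof.
move=> hx hz /eqP; rewrite eq_lines // => /eqP zE.
by rewrite /tang {3 4}zE !hformE hx mulr1.
Qed.

(** Apply [slice_count] along x to the vectors of the line: those orthogonal to x are the multiples
    of [z']. If [z'] is isotropic, all q^2 multiples are, leaving q^2 isotropic vectors in total,
    that is, one point. Otherwise only 0 is, leaving (q + 1)(q^2 - 1) nonzero isotropic vectors,
    that is, q + 1 points. *)
Lemma meet_countE x z : h x x = 1 -> h z z != 0 -> <[x]>%VS != <[z]>%VS ->
  meet_count q (<[x]> + <[z]>)%VS = (if tang x z then 1 else q.+1)%N.
Proof.
move=> hx hz neq_xz; set L := (_ + _)%VS.
pose S := [set w : vec | w \in L].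
pose z' := z - h z x *: x.
have z'0 : z' != 0 by rewrite subr_eq0 -eq_lines.
have hz'x : h z' x = 0 by rewrite !hformE hx mulr1 subrr.
have hz' : h z' z' = h z z - h z x * cj (h z x).
  by rewrite !hformE hx -(cj_hform z x); ring.
have tangE : tang x z = (h z' z' == 0) by rewrite /tang hz' subr_eq0 eq_sym.
have xL : x \in L by rewrite -(addr0 x) memv_add ?memv_line ?mem0v.
have zL : z \in L by rewrite -(add0r z) memv_add ?memv_line ?mem0v.
have LE : ((q ^ 2).-1 * meet_count q L)%N = #|level S 0 :\ 0|.
  rewrite /meet_count.
  have -> : [set Z in hermitian_variety F n q | (Z <= L)%VS] =
      [set Z in pg_points F n | (Z \in hermitian_variety F n q) && (Z <= L)%VS].
    by apply/setP => Z; rewrite !inE; case: (\dim Z == 1%N).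
  rewrite card_points; apply: eq_card => w.
  rewrite inE in_setD1 [w \in level _ _]inE [w \in S]inE.
  have [->//|w0] := eqVneq w 0.
  by rewrite /= line_in_variety // memvE [RHS]andbC.
have [m w|_] := @slice_count S x hx.
  by rewrite !inE => wL; rewrite memvD ?memvZ.
have -> : orth S x = [set m *: z' | m in [set: F]].
  apply/setP => w; rewrite !inE; apply/andP/imsetP => [[]|[m _ ->]]; last first.
    by rewrite hformZl hz'x mulr0 eqxx memvZ ?memvB ?memvZ.
  case/memv_addP => _ /vlineP[a ->] [_ /vlineP[b ->] ->].
  rewrite !hformE hx mulr1 => /eqP ab; exists b; rewrite ?inE //.
  rewrite /z' scalerBr scalerA addrC; congr (_ + _).
  by rewrite -scaleNr; congr (_ *: _); apply/eqP; rewrite -addr_eq0 ab.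
have inj_z : injective (fun m : F => m *: z').
  move=> a b /eqP; rewrite -subr_eq0 -scalerBl scaler_eq0 (negbTE z'0) orbF subr_eq0.
  by move/eqP.
rewrite (card_imset _ inj_z) cardsT cardF => eqS.
have S0 : 0 \in level S 0 by rewrite !inE mem0v hform0l eqxx.
apply/eqP; rewrite -(eqn_pmul2l q2_pred_gt0) LE; apply/eqP.
move: eqS; rewrite (cardsD1 0 (level S 0)) S0 tangE.
have [hz'0|hz'0] := eqVneq (h z' z') 0.
  have -> : level [set m *: z' | m in [set: F]] 0 = [set m *: z' | m in [set: F]].
    apply/setP => w; rewrite inE; apply: andb_idr => /imsetP[m _ ->].
    by rewrite hformZl hformZr hz'0 !mulr0.
  rewrite (card_imset _ inj_z) cardsT cardF muln1 mulSn => /addIn <-.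
  by rewrite add1n.
have -> : level [set m *: z' | m in [set: F]] 0 = [set 0].
  apply/setP => w; rewrite !inE; apply/andP/eqP => [[/imsetP[m _ ->]]|->].
    rewrite hformZl hformZr mulrA mulf_eq0 (negbTE hz'0) orbF norm_eq0 => /eqP->.
    by rewrite scale0r.
  by rewrite hform0l; split=> //; apply/imsetP; exists 0; rewrite ?scale0r.
rewrite cards1; set N := #|_|; rewrite -mulnn.
by case: (q) q_gt1 => // m _ /=; lia.
Qed.

Lemma perp_line x z : (<[x]> <= perp q <[z]>)%VS = (h z x == 0).
Proof.
rewrite -memvE; apply/mem_perp/eqP => [/(_ z (memv_line z)) xz|zx w /vlineP[k ->]].
  by rewrite -cj_hform xz rmorph0.
by rewrite hformZr -cj_hform zx rmorph0 mulr0.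
Qed.

(** Equality is included so that [tan_rel] agrees with [tang] on all anisotropic points; [rel1] is
    then the difference of [tan_rel] and equality. *)
Definition tan_rel X Z := (X == Z) || (meet_count q (X + Z)%VS == 1%N).
Definition perp_rel X Z := (X <= perp q Z)%VS.

Lemma tan_relE x z : h x x = 1 -> h z z != 0 -> tan_rel <[x]> <[z]> = tang x z.
Proof.
move=> hx hz; rewrite /tan_rel; have [xz|xz] /= := eqVneq <[x]>%VS <[z]>%VS.
  by rewrite tang_line.
by rewrite meet_countE //; case: tang; rewrite // eqSS; case: (q) q_gt1.
Qed.

Lemma perp_relE x z : perp_rel <[x]> <[z]> = ortho x z.
Proof. exact: perp_line. Qed.

Lemma perp_relC X Z : X \in PP -> Z \in PP -> perp_rel X Z = perp_rel Z X.
Proof.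
move=> /anisotropic_unit[x _ ->] /anisotropic_unit[z _ ->].
by rewrite !perp_relE /ortho -cj_hform fmorph_eq0.
Qed.

Lemma tan_relC X Z : tan_rel X Z = tan_rel Z X.
Proof. by rewrite /tan_rel eq_sym addvC. Qed.

Lemma tan_perp_disjoint X Z : X \in PP -> Z \in PP ->
  tan_rel X Z -> perp_rel X Z -> False.
Proof.
move=> /anisotropic_unit[x hx ->] /anisotropic_unit[z hz ->].
have hz0 : h z z != 0 by rewrite hz oner_neq0.
rewrite tan_relE // perp_relE /tang /ortho hz => + /eqP zx.
by rewrite zx mul0r eq_sym oner_eq0.
Qed.

Lemma meet_count_secant X Z : X \in PP -> Z \in PP -> ~~ tan_rel X Z ->
  meet_count q (X + Z)%VS = q.+1.
Proof.
move=> /anisotropic_unit[x hx ->] /anisotropic_unit[z hz ->].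
have hz0 : h z z != 0 by rewrite hz oner_neq0.
move=> ntan; rewrite meet_countE //; last by move: ntan; rewrite negb_or => /andP[].
by move: ntan; rewrite tan_relE // => /negbTE->.
Qed.

Lemma rel0E X Z : X \in PP -> Z \in PP -> ((X, Z) \in rel0 F n q) = (X == Z).
Proof. by move=> XP ZP; rewrite inE in_setX XP ZP. Qed.

Lemma rel1E X Z : X \in PP -> Z \in PP ->
  ((X, Z) \in rel1 F n q) = (X != Z) && tan_rel X Z.
Proof.
by move=> XP ZP; rewrite inE in_setX XP ZP /tan_rel /=; case: eqP.
Qed.

(** Perpendicular anisotropic points are never equal or tangent, so the line joining them is
    automatically secant. *)
Lemma rel2perpE X Z : X \in PP -> Z \in PP ->
  ((X, Z) \in rel2perp F n q) = perp_rel X Z.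
Proof.
move=> XP ZP; rewrite inE in_setX XP ZP /= -/(perp_rel X Z) andbA andbC.
apply: andb_idr => pXZ.
have ntan : ~~ tan_rel X Z by apply/negP => /(tan_perp_disjoint XP ZP)/(_ pXZ).
rewrite (meet_count_secant XP ZP ntan) eqxx andbT.
by move: ntan; rewrite negb_or => /andP[].
Qed.

Lemma rel2nperpE X Z : X \in PP -> Z \in PP ->
  ((X, Z) \in rel2nperp F n q) = ~~ tan_rel X Z && ~~ perp_rel X Z.
Proof.
move=> XP ZP; rewrite inE in_setX XP ZP /= -/(perp_rel X Z) andbA.
congr (_ && _); have [tanXZ|ntan] := boolP (tan_rel X Z); last first.
  by rewrite (meet_count_secant XP ZP ntan) eqxx andbT;
    move: ntan; case: eqP => // ->; rewrite /tan_rel eqxx.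
apply/negP => /andP[neqXZ /eqP mXZ]; move: tanXZ.
by rewrite /tan_rel (negbTE neqXZ) mXZ eqSS /=; case: (q) q_gt1.
Qed.

(** * Intersection numbers of the relations *)

Definition pcount (f g : rel subspace) X Y := #|[set Z in PP | f X Z && g Y Z]|.
Definition full_rel : rel subspace := fun _ _ => true.
Definition rels := [:: rel0 F n q; rel1 F n q; rel2perp F n q; rel2nperp F n q].

Lemma pcountC f g X Y : pcount f g X Y = pcount g f Y X.
Proof. by apply: eq_card => Z; rewrite !inE [f X Z && _]andbC. Qed.

Lemma pcount_vcount f g f' g' x y :
  (forall z, h z z != 0 -> f <[x]>%VS <[z]>%VS = f' x z) ->
  (forall z, h z z != 0 -> g <[y]>%VS <[z]>%VS = g' y z) ->
  pcount f g <[x]> <[y]> = (vcount f' g' x y %/ (q ^ 2).-1)%N.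
Proof.
move=> ff gg; have -> : vcount f' g' x y = ((q ^ 2).-1 * pcount f g <[x]> <[y]>)%N.
  rewrite card_anisotropic; apply: eq_card => z; rewrite !inE.
  by case: eqP => //= /eqP hz; rewrite ff ?gg.
by rewrite mulKn ?q2_pred_gt0.
Qed.

Lemma pcount_of_vcount (K : vec -> vec -> Prop) :
  (exists tt tp pp, forall x y, h x x = 1 -> h y y = 1 -> K x y ->
     [/\ vcount tang tang x y = tt, vcount tang ortho x y = tp
       & vcount ortho ortho x y = pp]) ->
  exists tt tp pp, forall x y, h x x = 1 -> h y y = 1 -> K x y ->
     [/\ pcount tan_rel tan_rel <[x]> <[y]> = tt,
         pcount tan_rel perp_rel <[x]> <[y]> = tp
       & pcount perp_rel perp_rel <[x]> <[y]> = pp].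
Proof.
case=> tt [tp [pp cK]].
exists (tt %/ (q ^ 2).-1)%N, (tp %/ (q ^ 2).-1)%N, (pp %/ (q ^ 2).-1)%N => x y hx hy xy.
have [<- <- <-] := cK x y hx hy xy.
by split; apply: pcount_vcount => z hz; rewrite ?tan_relE ?perp_relE.
Qed.

Lemma rels_anisotropic C X Y : C \in rels -> (X, Y) \in C -> X \in PP /\ Y \in PP.
Proof.
rewrite !in_cons in_nil orbF => /or4P[] /eqP->; rewrite inE in_setX;
  by case/andP => /andP[].
Qed.

Lemma rels_sym C X Y : C \in rels -> (X, Y) \in C -> (Y, X) \in C.
Proof.
move=> CR XYC; have [XP YP] := rels_anisotropic CR XYC; move: CR XYC.
rewrite !in_cons in_nil orbF => /or4P[] /eqP->.
- by rewrite !rel0E // eq_sym.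
- by rewrite !rel1E // eq_sym tan_relC.
- by rewrite !rel2perpE // perp_relC.
- by rewrite !rel2nperpE // perp_relC // tan_relC.
Qed.

Lemma pcount_rels C : C \in rels ->
  exists tt tp pp, forall X Y, (X, Y) \in C ->
     [/\ pcount tan_rel tan_rel X Y = tt, pcount tan_rel perp_rel X Y = tp
       & pcount perp_rel perp_rel X Y = pp].
Proof.
have norm_tang x y : h x x = 1 -> h y y = 1 ->
    tan_rel <[x]>%VS <[y]>%VS = (h x y * cj (h x y) == 1).
  move=> hx hy; rewrite tan_relE ?hy ?oner_neq0 // /tang hy.
  by rewrite -(cj_hform x y) cjK mulrC.
have perp0 x y : perp_rel <[x]>%VS <[y]>%VS = (h x y == 0).
  by rewrite perp_relE /ortho -(cj_hform x y) fmorph_eq0.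
move=> CR; have anis X Y := @rels_anisotropic C X Y CR.
move: CR anis; rewrite !in_cons in_nil orbF => /or4P[] /eqP-> anis.
(* Equal points can be given the same unit representative, so equality of vectors suffices as the
   condition. *)
- have [|tt [tp [pp cK]]] := @pcount_of_vcount (fun x y => x = y).
    have [tt [tp [pp cK]]] := vcount_self.
    by exists tt, tp, pp => x _ hx _ <-; apply: cK.
  exists tt, tp, pp => X Y XY; have [XP YP] := anis _ _ XY.
  move: XY; rewrite rel0E // => /eqP <-.
  by have [x hx ->] := anisotropic_unit XP; apply: cK.
- have [|tt [tp [pp cK]]] := @pcount_of_vcount
      (fun x y => h x y * cj (h x y) = 1 /\ x != h x y *: y).
    have [tt [tp [pp cK]]] := vcount_tangent.
    by exists tt, tp, pp => x y hx hy [a1 neq_xy]; apply: cK.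
  exists tt, tp, pp => X Y XY; have [XP YP] := anis _ _ XY.
  move: XY; rewrite rel1E //.
  have [x hx ->] := anisotropic_unit XP; have [y hy ->] := anisotropic_unit YP.
  rewrite norm_tang // eq_sym eq_lines ?hx ?oner_neq0 // => /andP[neq_xy /eqP a1].
  exact: cK.
- have [tt [tp [pp cK]]] := pcount_of_vcount vcount_perp.
  exists tt, tp, pp => X Y XY; have [XP YP] := anis _ _ XY.
  move: XY; rewrite rel2perpE //.
  have [x hx ->] := anisotropic_unit XP; have [y hy ->] := anisotropic_unit YP.
  by rewrite perp0 => /eqP; apply: cK.
- have [|tt [tp [pp cK]]] := @pcount_of_vcount
      (fun x y => h x y * cj (h x y) != 1 /\ h x y != 0).
    have [tt [tp [pp cK]]] := vcount_nperp.
    by exists tt, tp, pp => x y hx hy [a1 a0]; apply: cK.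
  exists tt, tp, pp => X Y XY; have [XP YP] := anis _ _ XY.
  move: XY; rewrite rel2nperpE //.
  have [x hx ->] := anisotropic_unit XP; have [y hy ->] := anisotropic_unit YP.
  by rewrite perp0 norm_tang // => /andP; apply: cK.
Qed.

Definition constant_on (C : {set subspace * subspace}) (f g : rel subspace) :=
  exists p, forall X Y, (X, Y) \in C -> pcount f g X Y = p.

Lemma constant_onC C f g : C \in rels -> constant_on C f g -> constant_on C g f.
Proof.
move=> CR [p cp]; exists p => X Y XY.
by rewrite pcountC; apply/cp/rels_sym.
Qed.

(** [pcount] is additive in the indicator function of its first relation, so constancy passes to
    differences. *)
Lemma constant_on_sub C (f f' f'' g : rel subspace) : C \in rels ->
  {in PP &, forall X Z, (f X Z + f' X Z = f'' X Z)%N} ->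
  constant_on C f g -> constant_on C f'' g -> constant_on C f' g.
Proof.
move=> CR ff [p cp] [p'' cp'']; exists (p'' - p)%N => X Y XY.
have [XP YP] := rels_anisotropic CR XY.
rewrite -(cp X Y XY) -(cp'' X Y XY).
have cntE k : pcount k g X Y = (\sum_(Z in PP) k X Z * g Y Z)%N.
  rewrite /pcount -sum1_card (eq_bigl (fun Z => (Z \in PP) && (k X Z && g Y Z))).
    by rewrite big_mkcondr; apply: eq_bigr => Z _; case: (k X Z); case: (g Y Z).
  by move=> Z; rewrite inE.
suff -> : pcount f'' g X Y = (pcount f g X Y + pcount f' g X Y)%N by rewrite addKn.
by rewrite !cntE -big_split; apply: eq_bigr => Z ZP; rewrite -ff // mulnDl.
Qed.

(** The indicators of the four classes arise by differences from those of equality, [tan_rel],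
    [perp_rel] and the full relation; P is any property stable under differences. *)
Lemma rels_span (P : rel subspace -> Prop) :
  (forall f f' f'' : rel subspace, {in PP &, forall X Z, (f X Z + f' X Z = f'' X Z)%N} ->
     P f -> P f'' -> P f') ->
  P eq_op -> P tan_rel -> P perp_rel -> P full_rel ->
  forall A, A \in rels -> P (fun X Z => (X, Z) \in A).
Proof.
move=> Psub Peq Ptan Pperp Pfull A.
(* Subtracting the empty relation transfers P between relations that agree on [PP]. *)
have P0 : P (fun _ _ => false) by apply: (Psub full_rel _ full_rel).
rewrite !in_cons in_nil orbF => /or4P[] /eqP->.
- by apply: (Psub _ _ _ _ P0 Peq) => X Z XP ZP; rewrite rel0E.
- apply: (Psub _ _ _ _ Peq Ptan) => X Z XP ZP; rewrite rel1E // /tan_rel.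
  by case: (X == Z).
- by apply: (Psub _ _ _ _ P0 Pperp) => X Z XP ZP; rewrite rel2perpE.
- apply: (Psub perp_rel _ (fun X Z => ~~ tan_rel X Z)) => // [X Z XP ZP|].
    rewrite rel2nperpE //; have := @tan_perp_disjoint X Z XP ZP.
    by case: (tan_rel X Z); case: (perp_rel X Z) => // /(_ isT isT).
  by apply: (Psub _ _ _ _ Ptan Pfull) => X Z _ _; rewrite /full_rel; case: (tan_rel X Z).
Qed.

Lemma rels_values C : C \in rels -> exists e t o, forall X Y, (X, Y) \in C ->
  [/\ (X == Y) = e, tan_rel X Y = t & perp_rel X Y = o].
Proof.
move=> CR; have anis X Y := @rels_anisotropic C X Y CR; move: CR anis.
have nperp X Y : X \in PP -> Y \in PP -> tan_rel X Y -> perp_rel X Y = false.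
  by move=> XP YP tXY; apply/negP; apply: tan_perp_disjoint.
have ntan X Y : X \in PP -> Y \in PP -> ~~ tan_rel X Y -> (X == Y) = false.
  by move=> XP YP; rewrite negb_or => /andP[/negbTE].
rewrite !in_cons in_nil orbF => /or4P[] /eqP-> anis.
- exists true, true, false => X Y XY; have [XP YP] := anis _ _ XY.
  move: XY; rewrite rel0E // => XY.
  have tXY : tan_rel X Y by rewrite /tan_rel XY.
  by rewrite nperp.
- exists false, true, false => X Y XY; have [XP YP] := anis _ _ XY.
  by move: XY; rewrite rel1E // => /andP[/negbTE XY tXY]; rewrite nperp.
- exists false, false, true => X Y XY; have [XP YP] := anis _ _ XY.
  move: XY; rewrite rel2perpE // => pXY.
  have tXY : ~~ tan_rel X Y by apply/negP => /nperp; rewrite pXY => /(_ XP YP).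
  by rewrite ntan // (negbTE tXY).
- exists false, false, false => X Y XY; have [XP YP] := anis _ _ XY.
  move: XY; rewrite rel2nperpE // => /andP[tXY pXY].
  by rewrite ntan // (negbTE tXY) (negbTE pXY).
Qed.

Lemma constant_on_rels A B C : A \in rels -> B \in rels -> C \in rels ->
  constant_on C (fun X Z => (X, Z) \in A) (fun Y Z => (Y, Z) \in B).
Proof.
move=> AR BR CR.
(* With equality as first relation only Z = X can be counted, so the count is the truth value of
   [g Y X]. *)
have const_eq (g : rel subspace) (b : bool) :
    (forall X Y, (X, Y) \in C -> g X Y = b) -> constant_on C eq_op g.
  move=> gb; exists (nat_of_bool b) => X Y XY.
  have [XP YP] := rels_anisotropic CR XY.
  rewrite -(gb _ _ (rels_sym CR XY)).
  have -> : nat_of_bool (g Y X) = #|[set Z | (Z == X) && g Y X]|.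
    case: (g Y X); first by rewrite -[LHS]/1%N -[LHS](cards1 X);
      apply: eq_card => Z; rewrite !inE andbT.
    by apply/esym/eqP; rewrite cards_eq0 -subset0; apply/subsetP => Z; rewrite inE andbF.
  apply: eq_card => Z; rewrite [LHS]inE [RHS]inE [Z == X]eq_sym.
  by case: (X =P Z) => [<-|]; rewrite ?andbF // XP.
have [tt [tp [pp cC]]] := pcount_rels CR.
have [e [t [o val]]] := rels_values CR.
have [vt [vtp [vp c0]]] : exists tt tp pp, forall X Y, (X, Y) \in rel0 F n q ->
     [/\ pcount tan_rel tan_rel X Y = tt, pcount tan_rel perp_rel X Y = tp
       & pcount perp_rel perp_rel X Y = pp].
  by apply: pcount_rels; rewrite mem_head.
(* Against the full relation the count is a valency, which is read off from the diagonal pair (X,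
   X). *)
have const_full (f : rel subspace) v :
    (forall X Y, (X, Y) \in rel0 F n q -> pcount f f X Y = v) ->
    constant_on C f full_rel.
  move=> cf; exists v => X Y XY; have [XP YP] := rels_anisotropic CR XY.
  rewrite -(cf X X) ?rel0E //; apply: eq_card => Z.
  by rewrite !inE andbT andbb.
have eq_eq : constant_on C eq_op eq_op by apply: (const_eq _ e) => X Y /val[].
have eq_tan : constant_on C eq_op tan_rel by apply: (const_eq _ t) => X Y /val[].
have eq_perp : constant_on C eq_op perp_rel by apply: (const_eq _ o) => X Y /val[].
have eq_full : constant_on C eq_op full_rel by apply: (const_eq _ true).
have tan_full : constant_on C tan_rel full_rel.
  by apply: (const_full _ vt) => X Y /c0[].
have perp_full : constant_on C perp_rel full_rel.
  by apply: (const_full _ vp) => X Y /c0[].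
have full_full : constant_on C full_rel full_rel.
  by exists #|PP| => X Y _; apply: eq_card => Z; rewrite inE andbT.
have tan_tan : constant_on C tan_rel tan_rel by exists tt => X Y /cC[].
have tan_perp : constant_on C tan_rel perp_rel by exists tp => X Y /cC[].
have perp_perp : constant_on C perp_rel perp_rel by exists pp => X Y /cC[].
have sw f g : constant_on C f g -> constant_on C g f by apply: constant_onC.
(* The count is bilinear, so [rels_span] is used once in each argument, reducing to the sixteen
   pairs of spanning relations. *)
pose Q f := constant_on C f (fun Y Z => (Y, Z) \in B).
suff : Q eq_op /\ Q tan_rel /\ Q perp_rel /\ Q full_rel.
  case=> Qe [Qt [Qp Qf]]; apply: (@rels_span Q) => // f f' f'' ff.
  exact: constant_on_sub.
have step f : constant_on C f eq_op -> constant_on C f tan_rel ->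
    constant_on C f perp_rel -> constant_on C f full_rel -> Q f.
  move=> fe ft fp ff; apply: (@rels_span (fun g => constant_on C f g)) => //.
  move=> g g' g'' gg cg cg''; apply/sw.
  by apply: (constant_on_sub CR gg); apply/sw.
by do !split; apply: step => //; apply/sw.
Qed.

(** * Each class is non-empty, and the classes partition the pairs *)

(** The index in [rels] of the class containing the pair. Equality is tested first because [tan_rel]
    contains it. *)
Definition color (u : subspace * subspace) : nat :=
  if u.1 == u.2 then 0%N else if tan_rel u.1 u.2 then 1%N
  else if perp_rel u.1 u.2 then 2%N else 3%N.

Lemma rels_color i : (i < 4)%N ->
  nth set0 rels i = [set u in setX PP PP | color u == i].
Proof.
move=> i4; apply/setP => -[X Z].
rewrite [RHS]inE in_setX.
have [XZ|nXZ] := boolP ((X \in PP) && (Z \in PP)); last first.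
  apply/negP => XZ; case/negP: nXZ; apply/andP.
  by apply: rels_anisotropic XZ; rewrite mem_nth.
case/andP: XZ => XP ZP; rewrite /color /=.
have dis := @tan_perp_disjoint X Z XP ZP.
have eqt : X == Z -> tan_rel X Z by rewrite /tan_rel => ->.
case: i i4 => [|[|[|[|//]]]] _ /=.
- by rewrite rel0E //; case: eqP => //; case: tan_rel => //; case: perp_rel.
- by rewrite rel1E //; case: eqP => //; case: tan_rel => //; case: perp_rel.
- rewrite rel2perpE //; case: eqP eqt => [_ /(_ isT) t|_ _].
    by apply/negP; apply: dis.
  by case: tan_rel dis => [/(_ isT)|_]; case: perp_rel => // /(_ isT).
- rewrite rel2nperpE //; case: eqP eqt => [_ /(_ isT) ->//|_ _].
  by case: tan_rel => //; case: perp_rel.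
Qed.

Lemma hform_delta (i j : 'I_n.+1) : h (delta_mx 0 i) (delta_mx 0 j) = (i == j)%:R.
Proof.
rewrite /hform (bigD1 i) //= big1 => [|k ki]; last by rewrite mxE (negbTE ki) andbF mul0r.
rewrite !mxE !eqxx mul1r addr0 -cjE; exact: rmorph_nat.
Qed.

Lemma orthonormal3 : (1 < n)%N -> exists e0 e1 e2 : vec,
  [/\ h e0 e0 = 1, h e1 e1 = 1, h e2 e2 = 1 &
  [/\ h e0 e1 = 0, h e0 e2 = 0, h e1 e0 = 0, h e1 e2 = 0 & h e2 e0 = 0 /\ h e2 e1 = 0]].
Proof.
move=> n_gt1; exists (delta_mx 0 ord0), (delta_mx 0 (inord 1)), (delta_mx 0 (inord 2)).
by rewrite !hform_delta !eqxx -!val_eqE /= !inordK ?ltnS // ltnW.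
Qed.

Lemma color_unit x y : h x x = 1 -> h y y = 1 ->
  color (<[x]>%VS, <[y]>%VS) =
    if <[x]>%VS == <[y]>%VS then 0%N else if h x y * cj (h x y) == 1 then 1%N
    else if h x y == 0 then 2%N else 3%N.
Proof.
move=> hx hy; rewrite /color /= tan_relE ?hy ?oner_neq0 // perp_relE /tang /ortho hy.
by rewrite -(cj_hform x y) fmorph_eq0 cjK [cj _ * _]mulrC.
Qed.

Lemma unit_pair x y : h x x = 1 -> h y y = 1 ->
  (<[x]>%VS, <[y]>%VS) \in setX PP PP.
Proof. by move=> hx hy; rewrite in_setX !line_anisotropic hx hy oner_neq0. Qed.

Lemma exists_real_neq01 : (2 < q)%N -> exists l, [/\ cj l = l, l != 0 & l != 1].
Proof.
move=> q_gt2; have /subsetPn[l lr] : ~~ ([set c : F | cj c == c] \subset [set 0; 1]).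
  apply/negP => /subset_leq_card; rewrite card_real cards2 [0 == 1]eq_sym oner_eq0 /=.
  by rewrite leqNgt q_gt2.
rewrite !inE negb_or => /andP[l0 l1]; exists l; split=> //.
by move: lr; rewrite inE => /eqP.
Qed.

Lemma real_q2 c : q = 2%N -> cj c = c -> c = 0 \/ c = 1.
Proof.
move=> q2 cc; have /eqP E : [set 0; 1] == [set c : F | cj c == c].
  rewrite eqEcard card_real cards2 [0 == 1]eq_sym oner_eq0 q2 andbT.
  by apply/subsetP => b; rewrite !inE => /orP[] /eqP->; rewrite ?rmorph0 ?rmorph1.
have : c \in [set 0; 1] by rewrite E inE cc.
by rewrite !inE => /orP[] /eqP; [left | right].
Qed.

(** The bound [3 + (q != 2)] is 3 or 4, the number of classes in the scheme; a pair in each is built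
    from orthonormal vectors. *)
Lemma color_surj i : (1 < n)%N -> (i < 3 + (q != 2))%N ->
  exists2 u : subspace * subspace, u \in setX PP PP & color u = i.
Proof.
move=> /orthonormal3[e0 [e1 [e2 [h0 h1 h2 [h01 h02 h10 h12 [h20 h21]]]]]].
have e0_neq0 : e0 != 0.
  by apply: contraTneq (oner_neq0 F) => e00; rewrite -h0 e00 hform0l eqxx.
have n01 : (0 == 1 :> F) = false by rewrite eq_sym oner_eq0.
(* A vector w orthogonal to [e0] but not to [h e0 y *: y] shows that these two vectors differ, hence
   that the points do. *)
have ne0 y w : h y y = 1 -> h e0 w = 0 -> h (h e0 y *: y) w != 0 ->
    (<[e0]>%VS == <[y]>%VS) = false.
  move=> hy hw; apply: contraNF; rewrite eq_sym eq_lines ?h0 ?oner_neq0 //.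
  by move=> /eqP <-; rewrite hw.
case: i => [|[|[|[|i]]]] ilt.
- by exists (<[e0]>%VS, <[e0]>%VS); rewrite ?unit_pair // color_unit // eqxx.
(* Tangent pair: with c of norm -1, [e1 + c *: e2] is isotropic and orthogonal to [e0], so adding it
   to [e0] keeps the vector unit and its product with [e0] equal to 1. The third orthonormal vector
   comes from n being at least 2. *)
- have [|c Nc] := @norm_surj (-1); first by rewrite rmorphN1.
  pose y := e0 + (e1 + c *: e2).
  have hy : h y y = 1.
    rewrite /y !hformE h0 h1 h2 h01 h02 h10 h12 h20 h21; ring: Nc.
  have h0y : h e0 y = 1 by rewrite /y !hformE h0 h01 h02 !mulr0 !addr0.
  exists (<[e0]>%VS, <[y]>%VS); first exact: unit_pair.
  rewrite color_unit // (ne0 y e1) //.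
    by rewrite h0y mul1r rmorph1 eqxx.
  by rewrite h0y scale1r /y !hformE h01 h1 h21 mulr0 add0r addr0 oner_neq0.
- exists (<[e0]>%VS, <[e1]>%VS); first exact: unit_pair.
  rewrite color_unit // h01 mul0r n01 eqxx.
  suff -> : (<[e0]>%VS == <[e1]>%VS) = false by [].
  by rewrite eq_sym eq_lines ?h0 ?oner_neq0 // h01 scale0r (negbTE e0_neq0).
- have q_gt2 : (2 < q)%N by move: ilt; case: (q) q_gt1 => [|[|[|]]].
  (* The product of [e0] and [y] will have norm l. Avoiding 0 and 1 makes the pair neither
     perpendicular nor tangent, and such an l exists in the subfield because it has more than two
     elements. *)
  have [l [lr l0 l1]] := exists_real_neq01 q_gt2.
  have [s Ns] := norm_surj lr.
  have [|t Nt] := @norm_surj (1 - l); first by rewrite rmorphB rmorph1 /= lr.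
  pose y := s *: e0 + t *: e1.
  have hy : h y y = 1.
    by rewrite /y !hformE h0 h1 h01 h10; ring: Ns Nt.
  have h0y : h e0 y = cj s by rewrite /y !hformE h0 h01 !mulr0 addr0 mulr1.
  have s0 : s != 0 by rewrite -norm_eq0 Ns.
  have t0 : t != 0 by rewrite -norm_eq0 Nt subr_eq0 eq_sym.
  exists (<[e0]>%VS, <[y]>%VS); first exact: unit_pair.
  rewrite color_unit // (ne0 y e1) // h0y.
    by rewrite cjK mulrC Ns (negbTE l1) fmorph_eq0 (negbTE s0).
  by rewrite /y !hformE h01 h1 mulr0 add0r mulr1 mulf_neq0 ?fmorph_eq0.
- by move: ilt; case: (q != 2).
Qed.

(** When [q] is 2 every norm is 0 or 1, so two distinct points are perpendicular or tangent and
    colour 3 does not occur. *)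
Lemma color_bound (u : subspace * subspace) : 
  u \in setX PP PP -> (color u < 3 + (q != 2))%N.
Proof.
case: u => X Y; rewrite in_setX => /andP[XP YP].
have [q2|_] := eqVneq q 2%N; last first.
  by rewrite /color; case: eqP => //; case: tan_rel => //; case: perp_rel.
have [x hx ->] := anisotropic_unit XP; have [y hy ->] := anisotropic_unit YP.
rewrite color_unit //; case: (_ == _ :> subspace) => //.
have [/eqP|->] := real_q2 q2 (cj_norm (h x y)); last by rewrite eqxx.
by rewrite norm_eq0 => ->; case: ifP.
Qed.

End HermitianCounting.

(** * Assembling the association scheme *)

Lemma partition_by_color (T : finType) (D : {set T}) (R : seq {set T}) (c : T -> nat) :
  (forall i, (i < size R)%N -> nth set0 R i = [set u in D | c u == i]) ->
  (forall u, u \in D -> (c u < size R)%N) ->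
  (forall i, (i < size R)%N -> exists2 u, u \in D & c u = i) ->
  uniq R /\ partition [set:: R] D.
Proof.
move=> RE cD surj; split.
  apply/(uniqP set0) => i j; rewrite !inE => iR jR.
  have [u uD ui] := surj i iR; rewrite !RE // => /setP/(_ u).
  by rewrite !inE uD ui eqxx => /esym/eqP.
have memR A : A \in R -> exists2 i, (i < size R)%N & A = [set u in D | c u == i].
  by move=> AR; exists (index A R); rewrite ?index_mem // -RE ?index_mem // nth_index.
apply/and3P; split.
- apply/eqP/setP => u; apply/bigcupP/idP => [[A]|uD].
    by rewrite inE => /memR[i _ ->]; rewrite inE => /andP[].
  exists (nth set0 R (c u)); first by rewrite inE mem_nth ?cD.
  by rewrite RE ?cD // inE uD eqxx.
- apply/trivIsetP => A B; rewrite !inE => /memR[i _ ->] /memR[j _ ->] neq.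
  rewrite -setI_eq0; apply/eqP/setP => u; rewrite !inE.
  apply/negP => /andP[/andP[_ /eqP ui] /andP[_ /eqP uj]].
  by case/eqP: neq; rewrite -ui -uj.
- rewrite inE; apply/negP => /memR[i iR /setP A0].
  by have [u uD ui] := surj i iR; have := A0 u; rewrite !inE uD ui eqxx.
Qed.

(** The k-fold iterate of Frobenius supplies conjugation as a ring morphism, the form in which the
    counting section takes it. *)
Lemma frobenius_power (F : finFieldType) p k : p \in [pchar F] ->
  exists cj : {rmorphism F -> F}, forall a, cj a = a ^+ (p ^ k).
Proof.
move=> chp; elim: k => [|k [f fE]]; first by exists idfun => a; rewrite expr1.
exists (pFrobenius_aut chp \o f) => a.
by rewrite /= fE pFrobenius_autE -exprM expnSr.
Qed.

Local Close Scope ring_scope.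

Theorem proposition3p2 (q n : nat)
    (hq : exists p k : nat, [/\ prime p, 0 < k & q = p ^ k])
    (hn : 2 <= n)
    (F : finFieldType) (hF : #|F| = q ^ 2) :
  (q = 2 -> rel2nperp F n q = set0) /\
  association_scheme (anisotropic_points F n q)
    ([:: rel0 F n q; rel1 F n q; rel2perp F n q]
       ++ (if q == 2 then [::] else [:: rel2nperp F n q])).
Proof.
have [p [k [p_pr k_gt0 qE]]] := hq.
have q_gt1 : 1 < q.
  by rewrite qE -{1}(exp1n k) ltn_exp2r ?prime_gt1.
have chp : p \in [pchar F]%R.
  by apply: (@card_finPcharP F p (k * 2)); rewrite // hF qE expnM.
have [cj cjE'] := frobenius_power k chp.
have cjE a : cj a = (a ^+ q)%R by rewrite cjE' qE.
set R := _ ++ _.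
(* The list of the scheme is a prefix of [rels], of length 3 when [q] is 2 and 4 otherwise, so facts
   proved for [rels] apply to both cases. *)
have RE : R = take (3 + (q != 2)) (rels F q n) by rewrite /R; case: eqP.
have memR A : A \in R -> A \in rels F q n by rewrite RE; apply: mem_take.
have szR : size R = 3 + (q != 2) by rewrite /R; case: eqP.
have colE i : i < 4 -> _ := @rels_color F q cj cjE hF q_gt1 n i.
have colB := @color_bound F q cj cjE hF q_gt1 n.
split.
  move=> q2; apply/setP => u; rewrite in_set0 -[rel2nperp F n q]/(nth set0 (rels F q n) 3).
  rewrite colE // inE; apply/negP => /andP[/colB + /eqP u3].
  by rewrite u3 q2.
have [|||uR pR] := @partition_by_color _ (setX (anisotropic_points F n q)
    (anisotropic_points F n q)) R (@color F q n).
- move=> i; rewrite szR => iR; rewrite RE nth_take // colE //.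
  by apply: leq_trans iR _; case: (q != 2).
- by move=> u /colB; rewrite szR.
- by move=> i; rewrite szR; apply: (color_surj cjE hF q_gt1 hn).
split=> //.
- by move=> A /memR AR X Y; apply: (rels_sym cjE hF q_gt1 AR).
- move=> A B C /memR AR /memR BR /memR CR.
  exact: (constant_on_rels cjE hF q_gt1 AR BR CR).
Qed.
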